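(* Let $X$ be a finite graph in which every vertex has positive degree, and let $P$ be a (Hermitian) symmetric transmission system on $X$. List the (real) eigenvalues of $\Delta^P$ with multiplicity as $\lambda_1(X,P)\le\lambda_2(X,P)\le\cdots$, and let $f_1\in C^0$ be any nonzero eigenvector with $\Delta^P f_1=\lambda_1(X,P)f_1$. Let $A\subset V(X)$, $B=V(X)\setminus A$, and suppose $vol_P(A)$ and $vol_P(B)$ are both nonzero. Then $$\lambda_2(X,P)-\lambda_1(X,P)\le K\,|\partial A|_P\left(\frac{1}{vol_P(A)}+\frac{1}{vol_P(B)}\right),$$ where $K=\max_{\vec e\in E^+(X)}\|P(\vec e)\|$. In particular, if $vol_P(A)\le vol_P(B)$, then $\lambda_2(X,P)-\lambda_1(X,P)\le 2K\,|\partial A|_P/vol_P(A)$.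
   Context: Graph conventions: $V(X)$ is the vertex set; each undirected edge gives two directed edges (a loop at $v$ gives two directed edges from $v$ to $v$); $E^+(X)$ is the set of directed edges; $i(\vec e)$, $t(\vec e)$ are initial and terminal points, $op(\vec e)$ is the reversed edge. Degree $d_w=\#\{\vec e: t(\vec e)=w\}$. A transmission system $P$ assigns to each vertex $v$ an integer $n(v)\ge0$ and to each directed edge $\vec e$ a complex $n(t(\vec e))\times n(i(\vec e))$ matrix $P(\vec e)$; it is (Hermitian) symmetric if $P(op(\vec e))=P(\vec e)^\star$ for all $\vec e$. Cochains $C^0=\bigoplus_v\mathbb{C}^{n(v)}$ with inner product $\sum_v\langle f(v),g(v)\rangle$. Transmission graph Laplacian: $(\Delta^P f)(w)=f(w)-\sum_{\vec e: t(\vec e)=w}(d_w d_{i(\vec e)})^{-1/2}P(\vec e)f(i(\vec e))$; for symmetric $P$ it is self-adjoint. Definitions: $vol_P(A)=\sum_{v\in A}\|f_1(v)\|^2$; $\partial A=\{\vec e: i(\vec e)\in A,\ t(\vec e)\in B\}$; $$|\partial A|_P=\sum_{\vec e\in\partial A}\frac{\|f_1(i(\vec e))\|}{\sqrt{d_{i(\vec e)}}}\cdot\frac{\|f_1(t(\vec e))\|}{\sqrt{d_{t(\vec e)}}}.$$ $\|P(\vec e)\|$ is the operator norm. *)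

(* Defs.v *)
From mathcomp Require Import all_boot all_order all_algebra.
From mathcomp Require Import complex.
From mathcomp Require Import all_classical all_reals.

Set Implicit Arguments.
Unset Strict Implicit.
Unset Printing Implicit Defensive.

Import Order.TTheory GRing.Theory Num.Theory.

Local Open Scope ring_scope.
Local Open Scope complex_scope.
Local Open Scope sesquilinear_scope.
Local Open Scope classical_set_scope.

(** Finite graphs, possibly with loops and multiple edges.  [dedge v w] is the
    set of directed edges [e] with i(e) = v and t(e) = w, so that the set of all
    directed edges is the disjoint union of the [dedge v w].  An undirected edge
    is a pair [{e, op e}]; since [op] has no fixed point, an undirected loop at
    [v] also consists of two distinct directed edges from [v] to [v]. *)
Record graph := Graph {
  vertex :> finType;
  dedge : vertex -> vertex -> finType;
  op : forall v w, dedge v w -> dedge w v;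
  opK : forall v w (e : dedge v w), op (op e) = e;
  op_neq : forall v (e : dedge v v), op e != e }.

Definition deg (X : graph) (w : X) : nat := (\sum_(v : X) #|dedge v w|)%N.

Section HermitianNorms.
Variable R : realType.

Definition vnorm n (u : 'cV[R[i]]_n) : R :=
  Num.sqrt (\sum_(j < n) ComplexField.Normc.normc (u j 0) ^+ 2).

Definition opnorm m n (M : 'M[R[i]]_(m, n)) : R :=
  sup [set vnorm (M *m u) | u in [set u : 'cV[R[i]]_n | vnorm u <= 1]].

End HermitianNorms.

Record transmission (R : realType) (X : graph) := Transmission {
  tdim : X -> nat;
  tmx : forall v w : X, dedge v w -> 'M[R[i]]_(tdim w, tdim v) }.

Section TransmissionLaplacian.
Variables (R : realType) (X : graph) (P : transmission R X).

Definition symmetric_transmission :=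
  forall (v w : X) (e : dedge v w), tmx P (op e) = (tmx P e)^t*.

Definition cochain := forall v : X, 'cV[R[i]]_(tdim P v).

Definition laplacian (f : cochain) : cochain := fun w =>
  f w - \sum_(v : X) \sum_(e : dedge v w)
          (Num.sqrt ((deg w)%:R * (deg v)%:R : R))^-1%:C *: (tmx P e *m f v).

(** The standard basis of the space of cochains is indexed by the pairs
    consisting of a vertex [v] and a coordinate [j < tdim P v]. *)
Definition cobasis (k : {v : X & 'I_(tdim P v)}) : cochain := fun v =>
  \col_j (Tagged (fun v => 'I_(tdim P v)) j == k)%:R.

Definition laplacian_mx : 'M[R[i]]_#|{: {v : X & 'I_(tdim P v)}}| :=
  \matrix_(j, k)
    laplacian (cobasis (enum_val k)) (tag (enum_val j)) (tagged (enum_val j)) 0.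

(** The complex roots, with multiplicity, of the characteristic polynomial.
    For symmetric [P] they are all real: see [char_poly_laplacian] below. *)
Definition eigenvalues : seq R :=
  sort <=%R
    [seq complex.Re z | z <- sval (closed_field_poly_normal (char_poly laplacian_mx))].

(** Numbered from 1: [lambda 1 <= lambda 2 <= ...]. *)
Definition lambda (k : nat) : R := nth 0 eigenvalues k.-1.

Lemma laplacian_mxE j k : laplacian_mx j k = (j == k)%:R -
  \sum_(e : dedge (tag (enum_val k)) (tag (enum_val j)))
    (Num.sqrt ((deg (tag (enum_val j)))%:R * (deg (tag (enum_val k)))%:R : R))^-1%:C
      * tmx P e (tagged (enum_val j)) (tagged (enum_val k)).
Proof.
have -> : j == k = (enum_val j == enum_val k) by rewrite (inj_eq enum_val_inj).
rewrite mxE; move: (enum_val j) (enum_val k) => [w a] [v b] /=.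
rewrite /laplacian /= !mxE; congr (_ - _).
rewrite summxE (bigD1 v) //= [X in _ + X]big1 ?addr0.
  rewrite summxE; apply: eq_bigr => e _; rewrite !mxE; congr (_ * _).
  rewrite (bigD1 b) //= mxE eqxx mulr1 big1 ?addr0 // => c /negbTE cb.
  by rewrite mxE -tag_eqE /tag_eq /= eqxx tagged_asE cb mulr0.
move=> u uv; rewrite summxE big1 // => e _; rewrite !mxE big1 ?mulr0 // => c _.
by rewrite mxE -tag_eqE /tag_eq /= (negbTE uv) mulr0.
Qed.

Lemma hermitian_laplacian_mx : symmetric_transmission -> laplacian_mx \is hermsymmx.
Proof.
move=> symP; apply/is_hermitianmxP; rewrite expr0 scale1r.
apply/matrixP => j k; rewrite [RHS]mxE laplacian_mxE [(_^T) _ _]mxE laplacian_mxE rmorphB /= rmorph_nat eq_sym.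
congr (_ - _); rewrite [RHS]rmorph_sum /=.
rewrite (reindex_onto (@op X _ _) (@op X _ _)) /=; last by move=> e _; exact: opK.
apply: eq_big => [e|e _]; first by rewrite opK eqxx.
rewrite rmorphM /= symP !mxE mulrC [RHS]mulrC; congr (_ * _).
by rewrite [in LHS]mulrC; apply/eqP; rewrite eq_complex /= oppr0 !eqxx.
Qed.

Lemma char_poly_laplacian : symmetric_transmission ->
  char_poly laplacian_mx = \prod_(l <- eigenvalues) ('X - l%:C%:P).
Proof.
move=> symP; have hM := hermitian_laplacian_mx symP.
rewrite /eigenvalues (perm_big _ (permEl (perm_sort _ _))) /= big_map.
case: closed_field_poly_normal => s /=.
rewrite (monicP (char_poly_monic _)) scale1r => sE; rewrite [LHS]sE.
rewrite big_seq [RHS]big_seq; apply: eq_bigr => z zs; congr ('X - _%:P).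
have : root (char_poly laplacian_mx) z by rewrite sE root_prod_XsubC.
rewrite -eigenvalue_root_char => /eigenvalueP[u uM u0].
have uu : (u *m u^t*) 0 0 != 0.
  by rewrite -dotmxE gt_eqF // dnorm_gt0.
have : z \is Num.real.
  apply/CrealP/(mulIf uu).
  have h1 : u *m laplacian_mx *m u^t* = z *: (u *m u^t*) by rewrite uM scalemxAl.
  have /(congr1 (fun A => A^t*)) := h1.
  rewrite !trmx_mul !map_mxM trmxCK.
  have /is_hermitianmxP := hM; rewrite expr0 scale1r => <-.
  rewrite mulmxA h1 linearZ /= map_mxZ trmx_mul map_mxM trmxCK.
  by move=> /(congr1 (fun A : 'M_1 => A 0 0)); rewrite !mxE.
by move=> /Creal_ImP; case: z {zs uM uu} => a b /=; rewrite -complexIm /= => -[->].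
Qed.

(** The default value 0 of the maximum is harmless: [opnorm] is nonnegative. *)
Definition max_opnorm : R :=
  \big[Num.max/0]_(v : X) \big[Num.max/0]_(w : X) \big[Num.max/0]_(e : dedge v w)
    opnorm (tmx P e).

Definition vol (f : cochain) (A : {set X}) : R :=
  \sum_(v in A) vnorm (f v) ^+ 2.

(** The total weight of the directed edges from [A] to its complement. *)
Definition boundary (f : cochain) (A : {set X}) : R :=
  \sum_(v in A) \sum_(w in ~: A) \sum_(e : dedge v w)
    (vnorm (f v) / Num.sqrt (deg v)%:R) * (vnorm (f w) / Num.sqrt (deg w)%:R).

End TransmissionLaplacian.

(* Main.v *)
(** Let [g] be [f1 / vol A] on [A] and [- f1 / vol B] on its complement [B].  It
    is orthogonal to [f1], so the spectral theorem bounds its Rayleigh quotient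
    from below by the second eigenvalue, the first one being simple if the gap
    is positive.  Writing [g v = c v *: f1 v], the eigenvalue equation for [f1]
    turns the energy of [g] into [lambda_1 * |g|^2] plus a sum over directed
    edges [v -> w] of multiples of [c w * (c w - c v)], to which only the edges
    between [A] and [B] contribute.  By Cauchy-Schwarz that sum is at most
    [K * |bd A| * (1 / vol A + 1 / vol B)^2], and
    [|g|^2 = 1 / vol A + 1 / vol B]. *)

Require Import Defs.
From mathcomp Require Import all_boot all_order all_algebra.
From mathcomp Require Import complex.
From mathcomp Require Import all_classical all_reals.
From mathcomp Require Import ring.

Set Implicit Arguments.
Unset Strict Implicit.
Unset Printing Implicit Defensive.

Import Order.TTheory GRing.Theory Num.Theory.
Local Open Scope ring_scope.
Local Open Scope complex_scope.
Local Open Scope sesquilinear_scope.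

(** * Rayleigh quotients of a Hermitian matrix *)

Lemma char_poly_similar (F : fieldType) n (U A D : 'M[F]_n) :
  U \in unitmx -> A = invmx U *m D *m U -> char_poly A = char_poly D.
Proof.
move=> Uu ->; rewrite /char_poly.
have VU : map_mx polyC (invmx U) *m map_mx polyC U = 1%:M.
  by rewrite -map_mxM mulVmx // map_mx1.
have -> : char_poly_mx (invmx U *m D *m U) =
    map_mx polyC (invmx U) *m char_poly_mx D *m map_mx polyC U.
  rewrite /char_poly_mx !map_mxM mulmxBr mulmxBl; congr (_ - _).
  by rewrite -scalemx1 -scalemxAr mulmx1 -scalemxAl VU.
by rewrite !det_mulmx mulrAC -det_mulmx VU det1 mul1r.
Qed.

(** In a unitary eigenbasis the strict gap forces [f] onto a single coordinate [j]. Orthogonality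
    then kills the [j]-th coordinate of [g], and every other diagonal entry is at least the second
    eigenvalue. *)
Lemma spectral_gap (R : realType) n (M : 'M[R[i]]_n) (s : seq R) (f g : 'cV_n) :
  M \is hermsymmx -> sorted <=%R s ->
  char_poly M = \prod_(l <- s) ('X - l%:C%:P) ->
  M *m f = (nth 0 s 0)%:C *: f -> f != 0 -> f^t* *m g = 0 ->
  nth 0 s 0 < nth 0 s 1 ->
  (nth 0 s 1)%:C * (g^t* *m g) 0 0 <= (g^t* *m M *m g) 0 0.
Proof.
move=> hM sS cM fE f0 fg gap.
have /orthomx_spectralP ME := hermitian_normalmx hM.
set U := spectralmx M in ME; set d := spectral_diag M in ME.
have Uu : U \is unitarymx := spectral_unitarymx M.
have UU : U^t* *m U = 1%:M.
  by rewrite -invmx_unitary // mulVmx // unitarymx_unit.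
rewrite invmx_unitary // in ME.
pose x := U *m f; pose y := U *m g.
have x0 : x != 0.
  apply: contra f0 => /eqP xE; apply/eqP.
  by rewrite -[f]mul1mx -UU -mulmxA -/x xE mulmx0.
have [j xj] : exists j, x j 0 != 0.
  by case/cV0Pn: x0 => j ?; exists j.
have dx : diag_mx d *m x = (nth 0 s 0)%:C *: x.
  rewrite /x scalemxAr -fE ME !mulmxA.
  by move/unitarymxP: Uu => ->; rewrite mul1mx.
have dxk k : x k 0 != 0 -> d 0 k = (nth 0 s 0)%:C.
  move=> xk; apply: (mulIf xk).
  by have /matrixP/(_ k 0) := dx; rewrite mul_diag_mx !mxE.
(* Both lists consist of the roots of [char_poly M], read off the diagonal form and the given
   factorization. The index [j] is put in front so that [d 0 j], which equals the head of [s], can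
   be cancelled. *)
have ps : perm_eq (d 0 j :: [seq d 0 k | k <- rem j (enum 'I_n)])
                  [seq l%:C | l <- s].
  have -> : d 0 j :: [seq d 0 k | k <- rem j (enum 'I_n)] =
            [seq d 0 k | k <- j :: rem j (enum 'I_n)] by [].
  apply: (@perm_trans _ [seq d 0 k | k <- enum 'I_n]).
    by apply: perm_map; rewrite perm_sym perm_to_rem // mem_enum.
  apply: prod_XsubC_eq; rewrite !big_map -cM -[Finite.enum _]enumT big_enum /=.
  rewrite (@char_poly_similar _ _ U M (diag_mx d)) ?unitarymx_unit //;
    last first.
    by rewrite invmx_unitary.
  rewrite char_poly_trig ?diag_mx_is_trig //.
  by apply: eq_bigr => k _; rewrite mxE eqxx mulr1n.
have dk k : k != j -> (nth 0 s 1)%:C <= d 0 k.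
  move=> kj.
  have kr : d 0 k \in [seq d 0 k | k <- rem j (enum 'I_n)].
    by apply: map_f; rewrite mem_rem_uniq ?enum_uniq // inE kj mem_enum.
  move: ps sS kr; rewrite (dxk j xj); case: (s) => [|a t] /=.
    by move=> /perm_size.
  (* After cancellation [d 0 k] lies in the tail of [s]. That tail is therefore nonempty, so the
     default value of [nth] does not arise, and its head is minimal by sortedness. *)
  rewrite perm_cons => /perm_mem -> pt /mapP[l lt ->].
  rewrite lecR; case: t lt pt => [//|b t] /=.
  rewrite inE => /orP[/eqP->//|lt] /andP[_].
  by rewrite (path_sortedE (@le_trans _ R)) => /andP[/allP/(_ _ lt)].
(* The lowest eigenvalue is simple, so [x = U f] is a multiple of the [j]-th
   basis vector. *)
have xk k : k != j -> x k 0 = 0.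
  move=> kj; apply/eqP; apply: contraTT gap => /dxk E.
  by have := dk k kj; rewrite E lecR -leNgt.
have yj : y j 0 = 0.
  have : x^t* *m y = 0.
    by rewrite /x /y trmx_mul map_mxM mulmxA -(mulmxA _ _ U) UU mulmx1 fg.
  move/matrixP/(_ 0 0); rewrite mxE [RHS]mxE (bigD1 j) //= big1 => [|k kj].
    rewrite addr0 2![in X in X * _]mxE => /eqP.
    by rewrite mulf_eq0 conjC_eq0 (negbTE xj) => /eqP.
  by rewrite 2![in X in X * _]mxE xk // conjC0 mul0r.
have -> : g^t* *m g = y^t* *m y.
  by rewrite /y trmx_mul map_mxM mulmxA -(mulmxA _ _ U) UU mulmx1.
have -> : g^t* *m M *m g = y^t* *m (diag_mx d *m y).
  by rewrite /y ME trmx_mul map_mxM !mulmxA.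
rewrite [(_ *m y) 0 0]mxE [leRHS]mxE mulr_sumr; apply: ler_sum => k _.
rewrite mul_diag_mx [(\matrix_(_, _) _) k 0]mxE 2!(mxE _ _ 0 k).
have [->|kj] := eqVneq k j; first by rewrite yj !mulr0.
rewrite [leRHS]mulrCA ler_wpM2r ?dk //.
by rewrite mulrC mul_conjC_ge0.
Qed.

(** * Norms and real inner products of complex vectors *)

Section Norms.
Variable R : realType.
Implicit Types m n : nat.

Lemma vnorm_ge0 n (u : 'cV[R[i]]_n) : 0 <= vnorm u.
Proof. exact: sqrtr_ge0. Qed.

Lemma normcE (z : R[i]) : `|z| = (ComplexField.Normc.normc z)%:C.
Proof. by case: z. Qed.

Lemma normc_ge0 (z : R[i]) : 0 <= ComplexField.Normc.normc z.
Proof. by rewrite -lecR -normcE normr_ge0. Qed.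

Lemma sqr_vnorm n (u : 'cV[R[i]]_n) :
  vnorm u ^+ 2 = \sum_j ComplexField.Normc.normc (u j 0) ^+ 2.
Proof. by rewrite sqr_sqrtr // sumr_ge0 // => j _; exact: sqr_ge0. Qed.

Lemma sqr_vnormC n (u : 'cV[R[i]]_n) : (vnorm u ^+ 2)%:C = (u^t* *m u) 0 0.
Proof.
rewrite sqr_vnorm mxE rmorph_sum; apply: eq_bigr => j _.
by rewrite 2!mxE rmorphXn /= -normcE normCK mulrC.
Qed.

Lemma vnorm_eq0 n (u : 'cV[R[i]]_n) : (vnorm u == 0) = (u == 0).
Proof.
apply/idP/eqP => [/eqP u0|->].
  have /eqP : \sum_j ComplexField.Normc.normc (u j 0) ^+ 2 = 0.
    by rewrite -sqr_vnorm u0 expr0n.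
  rewrite psumr_eq0 => [/allP uE|j _]; last exact: sqr_ge0.
  apply/matrixP => j k; rewrite ord1 mxE; apply: ComplexField.Normc.eq0_normc.
  by apply/eqP; rewrite -sqrf_eq0; apply: (implyP (uE j _));
    rewrite ?mem_index_enum.
rewrite -sqrf_eq0 sqr_vnorm big1 // => j _.
by rewrite mxE ComplexField.Normc.normc0 expr0n.
Qed.

Lemma vnorm0 n : vnorm (0 : 'cV[R[i]]_n) = 0.
Proof. by apply/eqP; rewrite vnorm_eq0. Qed.

Lemma vnormZ n (a : R) (u : 'cV[R[i]]_n) : vnorm (a%:C *: u) = `|a| * vnorm u.
Proof.
apply/eqP; rewrite -(eqrXn2 (n := 2)) ?vnorm_ge0 ?mulr_ge0 ?vnorm_ge0 //.
rewrite exprMn real_normK ?num_real // !sqr_vnorm mulr_sumr.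
apply/eqP; apply: eq_bigr => j _; rewrite mxE ComplexField.Normc.normcM exprMn.
by congr (_ * _); rewrite /= expr0n addr0 sqrtr_sqr real_normK ?num_real.
Qed.

(** Cauchy-Schwarz for [dotmx], which takes row vectors; hence the conjugate transposes. *)
Lemma normc_dot_le n (u v : 'cV[R[i]]_n) :
  ComplexField.Normc.normc ((u^t* *m v) 0 0) <= vnorm u * vnorm v.
Proof.
have : `|dotmx (u^t*) (v^t*)| ^+ 2 <= dotmx (u^t*) (u^t*) * dotmx (v^t*) (v^t*).
  by have [] := CauchySchwarz (@dotmx R[i] n) (u^t*) (v^t*).
rewrite !dotmxE !trmxCK -!sqr_vnormC normcE -!rmorphXn -rmorphM lecR.
by rewrite -exprMn ler_sqr ?nnegrE ?mulr_ge0 ?vnorm_ge0 ?normc_ge0.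
Qed.

Lemma ler_Re_normc (z : R[i]) : complex.Re z <= ComplexField.Normc.normc z.
Proof.
by apply: le_trans (ler_norm _) _; rewrite -lecR -normcE normc_ge_Re.
Qed.

(** Cauchy-Schwarz in each row. This Frobenius bound shows that the set defining [opnorm] is
    bounded, so that its [sup] is a genuine supremum. *)
Lemma vnorm_mulmx_frob m n (M : 'M[R[i]]_(m, n)) (u : 'cV_n) :
  vnorm (M *m u) ^+ 2 <= (\sum_i vnorm ((row i M)^t*) ^+ 2) * vnorm u ^+ 2.
Proof.
rewrite sqr_vnorm mulr_suml; apply: ler_sum => i _.
rewrite -exprMn ler_sqr ?nnegrE ?mulr_ge0 ?vnorm_ge0 ?normc_ge0 //.
have := normc_dot_le ((row i M)^t*) u; rewrite trmxCK.
by rewrite -row_mul mxE.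
Qed.

Lemma vnorm_mulmx_le m n (M : 'M[R[i]]_(m, n)) (u : 'cV_n) :
  vnorm (M *m u) <= opnorm M * vnorm u.
Proof.
have [->|u0] := eqVneq u 0; first by rewrite mulmx0 !vnorm0 mulr0.
have nu : 0 < vnorm u by rewrite lt_def vnorm_eq0 u0 vnorm_ge0.
rewrite -ler_pdivrMr // mulrC -[X in X * _]gtr0_norm ?invr_gt0 //.
rewrite -vnormZ scalemxAr.
apply: sup_upper_bound; last first.
  exists ((vnorm u)^-1%:C *: u) => //=.
  by rewrite vnormZ gtr0_norm ?invr_gt0 // mulVf ?gt_eqF.
split.
  by exists (vnorm (M *m (0 : 'cV_n))), 0; rewrite //= vnorm0.
exists (Num.sqrt (\sum_i vnorm ((row i M)^t*) ^+ 2)) => _ [v /= v1 <-].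
rewrite -[leLHS]ger0_norm ?vnorm_ge0 // -sqrtr_sqr.
rewrite ler_sqrt ?sumr_ge0 // => [|i _]; last exact: sqr_ge0.
apply: le_trans (vnorm_mulmx_frob M v) _.
by rewrite ler_piMr ?sumr_ge0 ?expr_le1 ?vnorm_ge0 // => i _; exact: sqr_ge0.
Qed.

(** Taking real parts moves the estimates from [R[i]] to the ordered field [R]. Homogeneity under
    real scalars is enough, as the cut function is real. *)
Definition re_dot n (u v : 'cV[R[i]]_n) : R := complex.Re ((u^t* *m v) 0 0).

Lemma ReD (x y : R[i]) : complex.Re (x + y) = complex.Re x + complex.Re y.
Proof. by case: x; case: y. Qed.

Lemma Re_sum (I : finType) (F : I -> R[i]) :
  complex.Re (\sum_i F i) = \sum_i complex.Re (F i).
Proof. exact: (big_morph _ ReD). Qed.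

Lemma ReZ (a : R) (x : R[i]) : complex.Re (a%:C * x) = a * complex.Re x.
Proof. by case: x => b c /=; rewrite mul0r subr0. Qed.

Lemma re_dotxx n (u : 'cV[R[i]]_n) : re_dot u u = vnorm u ^+ 2.
Proof. by rewrite /re_dot -sqr_vnormC. Qed.

Lemma re_dotDr n (u v w : 'cV[R[i]]_n) :
  re_dot u (v + w) = re_dot u v + re_dot u w.
Proof. by rewrite /re_dot mulmxDr mxE ReD. Qed.

Lemma re_dot0r n (u : 'cV[R[i]]_n) : re_dot u 0 = 0.
Proof. by rewrite /re_dot mulmx0 mxE. Qed.

Lemma re_dot_sumr n (I : finType) (u : 'cV[R[i]]_n) (F : I -> 'cV_n) :
  re_dot u (\sum_i F i) = \sum_i re_dot u (F i).
Proof. exact: (big_morph _ (re_dotDr u) (re_dot0r u)). Qed.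

Lemma re_dotZr n a (u v : 'cV[R[i]]_n) : re_dot u (a%:C *: v) = a * re_dot u v.
Proof. by rewrite /re_dot -scalemxAr mxE ReZ. Qed.

Lemma re_dotZl n a (u v : 'cV[R[i]]_n) : re_dot (a%:C *: u) v = a * re_dot u v.
Proof.
rewrite /re_dot linearZ /= map_mxZ -scalemxAl mxE -ReZ.
congr (complex.Re (_ * _)); exact: conjc_real.
Qed.

Lemma re_dot_mulmx_le m n (M : 'M[R[i]]_(m, n)) (u : 'cV_m) (v : 'cV_n) :
  re_dot u (M *m v) <= opnorm M * (vnorm v * vnorm u).
Proof.
apply: le_trans (ler_Re_normc _) (le_trans (normc_dot_le _ _) _).
by rewrite mulrC mulrA ler_wpM2r ?vnorm_ge0 // vnorm_mulmx_le.
Qed.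

End Norms.

(** * Cochains as column vectors *)

Section Cochains.
Variables (R : realType) (X : graph) (P : transmission R X).
Implicit Types f g : cochain P.

Definition vec f : 'cV[R[i]]_#|{: {v : X & 'I_(tdim P v)}}| :=
  \col_k f (tag (enum_val k)) (tagged (enum_val k)) 0.

Lemma sum_enum_val_sig (F : {v : X & 'I_(tdim P v)} -> R[i]) :
  \sum_(k < #|{: {v : X & 'I_(tdim P v)}}|) F (enum_val k) =
  \sum_v \sum_(j < tdim P v) F (Tagged (fun v => 'I_(tdim P v)) j).
Proof.
rewrite -(big_enum_val F) /=.
rewrite (sig_big_dep (J := fun v => 'I_(tdim P v)) predT (fun _ => predT)
  (fun v j => F (Tagged (fun v => 'I_(tdim P v)) j))) /=.
by apply: eq_bigr => -[].
Qed.

Lemma dot_vec f g : ((vec f)^t* *m vec g) 0 0 = \sum_v ((f v)^t* *m g v) 0 0.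
Proof.
rewrite mxE; under eq_bigr do rewrite 3!mxE [X in _ * X]mxE.
rewrite (sum_enum_val_sig
  (fun p => (f (tag p) (tagged p) 0)^* * g (tag p) (tagged p) 0)).
by apply: eq_bigr => v _; rewrite mxE; apply: eq_bigr => j _; rewrite 2!mxE.
Qed.

Lemma vec_eq0 f : (vec f == 0) = [forall v, f v == 0].
Proof.
apply/eqP/forallP => [f0 v|f0].
  apply/eqP/matrixP => j k; rewrite ord1 mxE.
  have /matrixP/(_ (enum_rank (Tagged (fun v => 'I_(tdim P v)) j)) 0) := f0.
  by rewrite !mxE enum_rankK.
by apply/matrixP => k l; rewrite !mxE (eqP (f0 _)) mxE.
Qed.

(** Together with [dot_vec], this carries the matrix estimate [spectral_gap] over to cochains. *)
Lemma mulmx_vec f : laplacian_mx P *m vec f = vec (laplacian f).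
Proof.
apply/matrixP => j l; rewrite ord1 {l} mxE [RHS]mxE.
under eq_bigr do rewrite laplacian_mxE mulrBl.
rewrite sumrB (bigD1 j) //= eqxx mul1r big1 ?addr0 => [|k kj]; last first.
  by rewrite eq_sym (negbTE kj) mul0r.
under [X in _ - X]eq_bigr do rewrite mxE.
rewrite [vec f j 0]mxE; case: (enum_val j) => w a /=.
rewrite (sum_enum_val_sig (fun p => (\sum_(e : dedge (tag p) w)
   (Num.sqrt ((deg w)%:R * (deg (tag p))%:R : R))^-1%:C * tmx P e a (tagged p))
   * f (tag p) (tagged p) 0)) /=.
rewrite /laplacian !mxE summxE; congr (_ - _); apply: eq_bigr => v _.
rewrite summxE; under eq_bigr do rewrite mulr_suml.
rewrite exchange_big /=; apply: eq_bigr => e _.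
by rewrite !mxE mulr_sumr; apply: eq_bigr => b _; rewrite mulrA.
Qed.

End Cochains.

(** * Energy of an eigenvector multiplied by a real function *)

Section ModulatedEigenvector.
Variables (R : realType) (X : graph) (P : transmission R X).

(** In each edge term of [laplacian g w], write [c v] as [c w - (c w - c v)]. The first parts
    reassemble into [c w] times [laplacian f w], where the eigenvalue equation applies; the second
    parts form the edge sum. *)
Lemma re_dot_modulated_laplacian (f : cochain P) (l : R) (c : X -> R) :
  (forall w, laplacian f w = l%:C *: f w) ->
  let g : cochain P := fun v => (c v)%:C *: f v in
  \sum_w re_dot (g w) (laplacian g w) =
  l * \sum_w c w ^+ 2 * vnorm (f w) ^+ 2 +
  \sum_w \sum_v \sum_(e : dedge v w) c w * (c w - c v) *
    ((Num.sqrt ((deg w)%:R * (deg v)%:R))^-1 * re_dot (f w) (tmx P e *m f v)).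
Proof.
move=> fE g; rewrite mulr_sumr -big_split; apply: eq_bigr => w _ /=.
have -> : laplacian g w = (c w * l)%:C *: f w + \sum_v \sum_(e : dedge v w)
   ((c w - c v) * (Num.sqrt ((deg w)%:R * (deg v)%:R))^-1)%:C *:
     (tmx P e *m f v).
  rewrite rmorphM -scalerA -fE /laplacian scalerBr -addrA; congr (_ + _).
  rewrite scaler_sumr -!sumrN -big_split; apply: eq_bigr => v _ /=.
  rewrite scaler_sumr -!sumrN -big_split; apply: eq_bigr => e _ /=.
  rewrite /g -scalemxAr !scalerA -!scaleNr -scalerDl; congr (_ *: _).
  by rewrite rmorphM rmorphB /=; ring.
rewrite re_dotDr re_dotZr re_dotZl re_dotxx re_dot_sumr.
congr (_ + _); first by ring.
apply: eq_bigr => v _; rewrite re_dot_sumr; apply: eq_bigr => e _.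
by rewrite re_dotZr re_dotZl; ring.
Qed.

Lemma le_max_opnorm v w (e : dedge v w) : opnorm (tmx P e) <= max_opnorm P.
Proof.
apply: le_trans (le_bigmax _ _ v); apply: le_trans (le_bigmax _ _ w).
exact: (le_bigmax _ (fun e : dedge v w => opnorm (tmx P e))).
Qed.

Lemma max_opnorm_ge0 : 0 <= max_opnorm P.
Proof. exact: bigmax_ge_id. Qed.

Lemma card_dedgeC (v w : X) : #|dedge v w| = #|dedge w v|.
Proof.
by apply: (bij_eq_card (f := @op X v w)); exists (@op X w v); exact: opK.
Qed.

(** The inner sum of [boundary], isolated because its symmetry in [v] and [w] (through [op]) lets
    the two directions across the cut be combined. *)
Definition edge_weight (f : cochain P) v w : R :=
  \sum_(e : dedge v w)
    (vnorm (f v) / Num.sqrt (deg v)%:R) * (vnorm (f w) / Num.sqrt (deg w)%:R).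

Lemma edge_weightC f v w : edge_weight f v w = edge_weight f w v.
Proof. by rewrite /edge_weight !sumr_const card_dedgeC mulrC. Qed.

Lemma edge_weight_ge0 f v w : 0 <= edge_weight f v w.
Proof.
rewrite sumr_ge0 // => e _.
by rewrite !mulr_ge0 ?invr_ge0 ?sqrtr_ge0 ?vnorm_ge0.
Qed.

Lemma edge_energy_le (f : cochain P) v w :
  \sum_(e : dedge v w)
    (Num.sqrt ((deg w)%:R * (deg v)%:R))^-1 * re_dot (f w) (tmx P e *m f v) <=
  max_opnorm P * edge_weight f v w.
Proof.
rewrite mulr_sumr; apply: ler_sum => e _.
rewrite sqrtrM // invfM.
have -> : max_opnorm P * (vnorm (f v) / Num.sqrt (deg v)%:R *
   (vnorm (f w) / Num.sqrt (deg w)%:R)) =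
  (Num.sqrt (deg w)%:R)^-1 * (Num.sqrt (deg v)%:R)^-1 *
     (max_opnorm P * (vnorm (f v) * vnorm (f w))) by ring.
rewrite ler_wpM2l ?mulr_ge0 ?invr_ge0 ?sqrtr_ge0 //.
apply: le_trans (re_dot_mulmx_le _ _ _) _.
by rewrite ler_wpM2r ?mulr_ge0 ?vnorm_ge0 ?le_max_opnorm.
Qed.

End ModulatedEigenvector.

(** * Functions constant on each side of the cut *)

Section Cut.
Variables (R : realType) (X : graph) (P : transmission R X).
Implicit Types (f g : cochain P) (A : {set X}).

Definition two_valued A (x y : R) (v : X) : R := if v \in A then x else y.

Lemma sum_two_valued A (x y : R) (F : X -> R) :
  \sum_v two_valued A x y v * F v =
  x * (\sum_(v in A) F v) + y * (\sum_(v in ~: A) F v).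
Proof.
rewrite (bigID (mem A)) /= !mulr_sumr; congr (_ + _).
  by apply: eq_bigr => v vA; rewrite /two_valued vA.
by apply: eq_big => [v|v /negbTE vA]; rewrite ?inE // /two_valued vA.
Qed.

Lemma vol_ge0 f A : 0 <= vol f A.
Proof. by apply: sumr_ge0 => v _; exact: sqr_ge0. Qed.

Lemma boundary_ge0 f A : 0 <= boundary f A.
Proof.
by apply: sumr_ge0 => v _; apply: sumr_ge0 => w _; exact: edge_weight_ge0.
Qed.

(** Only pairs separated by [A] contribute: [x * (x - y)] when [w] is in [A], and [y * (y - x)] when
    [v] is. By symmetry both kinds have total weight [boundary f A], and the two coefficients add up
    to [(x - y) ^+ 2]. *)
Lemma two_valued_energy f A (x y : R) :
  let c := two_valued A x y in
  \sum_w \sum_v c w * (c w - c v) * edge_weight f v w =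
  (x - y) ^+ 2 * boundary f A.
Proof.
move=> c; have E w : \sum_v c w * (c w - c v) * edge_weight f v w =
  two_valued A (x * (x - y)) 0 w * (\sum_(v in ~: A) edge_weight f w v) +
  two_valued A 0 (y * (y - x)) w * (\sum_(v in A) edge_weight f v w).
  rewrite addrC; under [X in _ = _ + _ * X]eq_bigr do rewrite edge_weightC.
  rewrite -sum_two_valued; apply: eq_bigr => v _.
  congr (_ * _); rewrite /c /two_valued.
  by case: (w \in A); case: (v \in A); rewrite ?subrr ?mulr0.
under eq_bigr do rewrite E.
rewrite big_split /= !sum_two_valued !mul0r addr0 add0r exchange_big /=.
have -> : boundary f A = \sum_(w in ~: A) \sum_(v in A) edge_weight f v w.
  by rewrite exchange_big.
by ring.
Qed.

End Cut.

(** * The test cochain and the gap inequality *)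

Theorem theorem2 (R : realType) (X : graph) (P : transmission R X)
    (deg_gt0 : forall w : X, (0 < deg w)%N)
    (symP : symmetric_transmission P)
    (f1 : cochain P)
    (f1_neq0 : exists v : X, f1 v != 0)
    (f1_eigen : forall w : X, laplacian f1 w = (lambda P 1)%:C *: f1 w)
    (A : {set X})
    (volA_neq0 : vol f1 A != 0)
    (volB_neq0 : vol f1 (~: A) != 0) :
  lambda P 2 - lambda P 1 <=
    max_opnorm P * boundary f1 A * ((vol f1 A)^-1 + (vol f1 (~: A))^-1)
  /\ (vol f1 A <= vol f1 (~: A) ->
      lambda P 2 - lambda P 1 <= 2 * max_opnorm P * boundary f1 A / vol f1 A).
Proof.
set a := vol f1 A in volA_neq0 *; set b := vol f1 (~: A) in volB_neq0 *.
have a0 : 0 < a by rewrite lt_def volA_neq0 vol_ge0.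
have b0 : 0 < b by rewrite lt_def volB_neq0 vol_ge0.
have K0 : 0 <= max_opnorm P * boundary f1 A.
  by rewrite mulr_ge0 ?max_opnorm_ge0 ?boundary_ge0.
suff main : lambda P 2 - lambda P 1 <=
    max_opnorm P * boundary f1 A * (a^-1 + b^-1).
  split=> // ab; apply: le_trans main _.
  rewrite (_ : 2 * _ * _ / a = max_opnorm P * boundary f1 A * (a^-1 + a^-1)).
    by rewrite ler_wpM2l // lerD2l lef_pV2 ?posrE.
  by ring.
(* Without a strict gap the left side is at most 0 and the right side is nonnegative. The strict
   case supplies the hypothesis of [spectral_gap]. *)
have [gap|] := ltP (lambda P 1) (lambda P 2); last first.
  rewrite -subr_le0 => /le_trans; apply.
  by rewrite mulr_ge0 // addr_ge0 // invr_ge0 ltW.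
(* With these values the inner product of [f1] and [g] is [a / a - b / b = 0]. *)
pose c := two_valued A a^-1 (- b^-1).
pose g : cochain P := fun v => (c v)%:C *: f1 v.
have c2 v : c v ^+ 2 = two_valued A (a^-1 ^+ 2) (b^-1 ^+ 2) v.
  by rewrite /c /two_valued; case: ifP; rewrite ?sqrrN.
have normg : \sum_v c v ^+ 2 * vnorm (f1 v) ^+ 2 = a^-1 + b^-1.
  under eq_bigr do rewrite c2.
  rewrite sum_two_valued -/(vol f1 A) -/(vol f1 (~: A)) -/a -/b.
  by rewrite !expr2 -!mulrA !mulVf // !mulr1.
have fg : (vec f1)^t* *m vec g = 0.
  apply/matrixP => i j; rewrite !ord1 dot_vec mxE.
  under eq_bigr do rewrite -scalemxAr mxE -sqr_vnormC -rmorphM.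
  rewrite -rmorph_sum /c sum_two_valued -/(vol f1 A) -/(vol f1 (~: A)) -/a -/b.
  by rewrite mulNr !mulVf // subrr.
have f0 : vec f1 != 0.
  rewrite vec_eq0; apply/forallPn; case: f1_neq0 => v fv; by exists v.
have gapg : lambda P 2 * (a^-1 + b^-1) <= \sum_v re_dot (g v) (laplacian g v).
  have ef : laplacian_mx P *m vec f1 = (lambda P 1)%:C *: vec f1.
    rewrite mulmx_vec; apply/matrixP => i j.
    by rewrite mxE f1_eigen [RHS]mxE [vec f1 i j]mxE mxE.
  have := spectral_gap (hermitian_laplacian_mx symP)
    (sort_sorted (@le_total _ R) _)
    (char_poly_laplacian symP) ef f0 fg gap.
  (* The order on [R[i]] compares real parts and requires equal imaginary parts; only the real
     comparison is kept. *)
  rewrite -mulmxA mulmx_vec !dot_vec lecE => /andP[_].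
  rewrite ReZ !Re_sum -normg; congr (_ * _ <= _); apply: eq_bigr => v _.
  by rewrite -/(re_dot (g v) (g v)) re_dotZl re_dotZr re_dotxx mulrA -expr2.
have gE := re_dot_modulated_laplacian c f1_eigen; rewrite /= -/g normg in gE.
have cut_le : \sum_w \sum_v \sum_(e : dedge v w) c w * (c w - c v) *
    ((Num.sqrt ((deg w)%:R * (deg v)%:R))^-1 *
      re_dot (f1 w) (tmx P e *m f1 v)) <=
    max_opnorm P * boundary f1 A * (a^-1 + b^-1) ^+ 2.
  (* The sum [a^-1 + b^-1] is the difference of the two values of [c], so its square is the factor
     in [two_valued_energy]. *)
  rewrite -mulrA [boundary _ _ * _]mulrC -[b^-1]opprK -two_valued_energy -/c.
  rewrite mulr_sumr; apply: ler_sum => w _.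
  rewrite mulr_sumr; apply: ler_sum => v _.
  (* The two values of [c] have opposite signs, so [c w * (c w - c v)] is never negative and the
     one-sided bound [edge_energy_le] may be multiplied by it. *)
  rewrite -mulr_sumr mulrCA ler_wpM2l ?edge_energy_le //.
  rewrite /c /two_valued; case: (w \in A); case: (v \in A);
    rewrite ?subrr ?mulr0 //.
    by rewrite opprK mulr_ge0 ?addr_ge0 ?invr_ge0 ?ltW.
  by rewrite -opprD mulrNN mulr_ge0 ?addr_ge0 ?invr_ge0 ?ltW.
have ab0 : 0 < a^-1 + b^-1 by rewrite addr_gt0 ?invr_gt0.
(* Multiplying by [a^-1 + b^-1], the squared norm of [g], turns the goal into a comparison of
   energies. *)
rewrite -(ler_pM2r ab0) mulrBl -[leRHS]mulrA -expr2 lerBlDl.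
by apply: le_trans gapg _; rewrite gE lerD2l.
Qed.
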